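(* Let $-\infty<a<b<\infty$, let $n,m$ be integers with $3\le m\le n-1$, let $f\in\mathcal C^n([a,b])$, and let $g\in L$ be any function with $g(E)\subseteq[a,b]$ and $f\circ g\in L$. If $f$ is $n$-convex and $m$ is odd, then $$LR(f,g,a,b,A)\le (b-A(g))\left(f[a,b]-f[b,b]\right)+\sum_{k=2}^{m-1}\frac{f^{(k)}(b)}{k!}A\left[(g-b\mathbf 1)^{k}\right]+\sum_{k=1}^{n-m}f[\underbrace{b,\dots,b}_{m\text{ times}};\underbrace{a,\dots,a}_{k\text{ times}}]\,A\left[(g-b\mathbf 1)^{m}(g-a\mathbf 1)^{k-1}\right].$$ The same inequality also holds when $f$ is $n$-concave and $m$ is even. If $f$ is $n$-convex and $m$ is even, or if $f$ is $n$-concave and $m$ is odd, then the inequality holds with the sign reversed ($\ge$ in place of $\le$).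
   Context: $E$ is a non-empty set; $L$ is a vector space (under pointwise operations) of functions $E\to\mathbb R$ containing the constant function $\mathbf 1$ (with $\mathbf 1(t)=1$ for all $t\in E$). $A\colon L\to\mathbb R$ is a positive linear functional (linear, and $A(h)\ge 0$ whenever $h\in L$ and $h(t)\ge0$ for all $t\in E$) with $A(\mathbf 1)=1$. Products and powers of functions are pointwise, and $(g-a\mathbf 1)^0=\mathbf 1$. $$LR(f,g,a,b,A)=A(f\circ g)-\frac{b-A(g)}{b-a}f(a)-\frac{A(g)-a}{b-a}f(b).$$ Divided differences: for $f\in\mathcal C^n([a,b])$ and points $t_0\le t_1\le\dots\le t_k$ in $[a,b]$, $k\le n$, not necessarily distinct, $f[t_0,\dots,t_k]=f^{(k)}(t_0)/k!$ if $t_0=t_k$, and $f[t_0,\dots,t_k]=\dfrac{f[t_1,\dots,t_k]-f[t_0,\dots,t_{k-1}]}{t_k-t_0}$ otherwise. The value is taken to be independent of the order in which the points are listed; commas and semicolons both separate points. In particular $f[b,b]=f'(b)$. A function $f\colon[a,b]\to\mathbb R$ is $n$-convex if $f[t_0,\dots,t_n]\ge0$ for all choices of $n+1$ distinct points $t_0,\dots,t_n\in[a,b]$; it is $n$-concave if $-f$ is $n$-convex. *)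

(* Defs.v *)
From HB Require Import structures.
From mathcomp Require Export all_boot all_order all_algebra.
From mathcomp Require Export all_classical all_reals all_analysis.

Set Implicit Arguments.
Unset Strict Implicit.
Unset Printing Implicit Defensive.

Import Order.TTheory GRing.Theory Num.Theory.
Import numFieldNormedType.Exports.

Local Open Scope classical_set_scope.
Local Open Scope ring_scope.

Section derivatives.
Context {R : realType}.
Implicit Types (a b : R) (f : R -> R) (n : nat).

(* A function on [a, b] is represented by a total function on R, of which only
   the values on [a, b] matter.  The limits below are taken inside [a, b], so
   that derivatives at a and b are one-sided. *)
Definition diff_quotient f (x y : R) : R := (f y - f x) / (y - x).

Definition derivable_on a b f (x : R) : Prop :=
  cvg (diff_quotient f x y @[y --> within `[a, b] x^']).

Definition derive_on a b f (x : R) : R :=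
  lim (diff_quotient f x y @[y --> within `[a, b] x^']).

Definition derive_onn a b n f : R -> R := iter n (derive_on a b) f.

Definition Cn_on a b n f : Prop :=
  (forall k, (k < n)%N -> {in `[a, b], forall x,
     derivable_on a b (derive_onn a b k f) x}) /\
  {within `[a, b], continuous (derive_onn a b n f)}.

End derivatives.

Section divided_differences.
Context {R : realType}.
Implicit Types (a b : R) (f : R -> R) (s : seq R).

(* f[t_0, ..., t_k] for a nondecreasing list t_0 :: [:: t_1; ...; t_k] in [a, b].
   [k] is the size of the tail; it is an argument only so that the recursion
   is structural. *)
Fixpoint divdiff_rec a b f (k : nat) s : R :=
  let t0 := head 0 s in
  let tk := last 0 s in
  if t0 == tk then derive_onn a b k f t0 / (k`!)%:R
  else if k is k'.+1 then
    (divdiff_rec a b f k' (behead s)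
     - divdiff_rec a b f k' (take k'.+1 s)) / (tk - t0)
  else 0.

(* The points may be listed in any order: they are sorted first. *)
Definition divdiff a b f s : R :=
  divdiff_rec a b f (size s).-1 (sort <=%R s).

Definition n_convex a b (n : nat) f : Prop :=
  forall s, size s = n.+1 -> uniq s -> {subset s <= `[a, b]} ->
    0 <= divdiff a b f s.

Definition n_concave a b (n : nat) f : Prop := n_convex a b n (\- f).

End divided_differences.

Section functionals.
Context {R : realType} {E : Type}.

(* A functional on a space L of functions is represented by a total map, of
   which only the values on L matter. *)
Definition positive_linear_functional (L : {pred E -> R}) (A : (E -> R) -> R) :
    Prop :=
  [/\ {in L &, forall h1 h2, A (h1 + h2) = A h1 + A h2},
      {in L, forall h (c : R), A (c *: h) = c * A h} &
      {in L, forall h, (forall t, 0 <= h t) -> 0 <= A h}].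

Definition LR (f : R -> R) (g : E -> R) (a b : R) (A : (E -> R) -> R) : R :=
  A (f \o g) - (b - A g) / (b - a) * f a - (A g - a) / (b - a) * f b.

End functionals.

(* Main.v *)
(* Let N be the polynomial of degree at most n - 1 interpolating f at b, m
   times, and at a, n - m times.  In Newton's form, rhs - LR = A (N \o g) - A (f \o g).
   Hermite's remainder formula, which follows from Rolle's theorem, reads
     f t - N t = f^(n)(c) / n! * (t - b)^m * (t - a)^(n - m)
   for some c in [a, b].  There (t - b)^m has the sign of (-1)^m, and
   n-convexity gives f^(n) >= 0: otherwise f^(n) would be negative near some
   point, and so would be a divided difference at n + 1 points near it. *)
Require Import Defs.
From mathcomp Require Import ring lra.
Import Order.TTheory GRing.Theory Num.Theory.
Import numFieldNormedType.Exports.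

Set Implicit Arguments.
Unset Strict Implicit.
Unset Printing Implicit Defensive.

Local Open Scope classical_set_scope.
Local Open Scope ring_scope.

(** * Divided differences along sorted lists *)

Section divided_difference_recursion.
Context {R : realType}.
Implicit Types (a b x y : R) (f : R -> R) (s u : seq R).

(** Induction along the recursion of [divdiff_rec], which drops either end. A sorted list whose ends
    agree is squeezed between them, hence constant: these are the base cases. *)
Lemma sorted_ends_ind (P : seq R -> Prop) :
  (forall k x, P (nseq k.+1 x)) ->
  (forall x u y, x < y -> P (x :: u) -> P (rcons u y) -> P (x :: rcons u y)) ->
  forall s, sorted <=%R s -> (0 < size s)%N -> P s.
Proof.
move=> P_const P_step s; have [k] := ubnP (size s); elim: k s => // k IHk.
case=> // x s; case/lastP: s => [_ _ _|u y]; first exact: (P_const 0%N).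
rewrite /= size_rcons !ltnS => le_uk s_sorted _.
have := s_sorted; rewrite -[path _ _ _]/(sorted <=%R (x :: rcons u y)).
rewrite sorted_pairwise; last exact: le_trans.
rewrite pairwise_cons pairwise_rcons all_rcons -/(pairwise _).
move=> /andP[/andP[le_xy /allP x_le]] /andP[/allP le_y u_sorted].
have [lt_xy|le_yx] := ltP x y.
  have trans := @le_trans _ R.
  apply: P_step => //; apply: IHk; rewrite ?size_rcons // sorted_pairwise //.
    by rewrite pairwise_cons u_sorted andbT; apply/allP.
  by rewrite pairwise_rcons u_sorted andbT; apply/allP.
have -> : y = x by apply/le_anti; rewrite le_yx.
suff /all_pred1P -> : all (pred1 x) (x :: rcons u x) by exact: P_const.
rewrite /= all_rcons /= eqxx /=; apply/allP => z zu /=.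
by rewrite eq_le x_le // (le_trans (le_y _ zu)).
Qed.

Lemma divdiff_rec_nseq a b f k x :
  divdiff_rec a b f k (nseq k.+1 x) = derive_onn a b k f x / k`!%:R.
Proof.
case: k => [|k] /=; first by rewrite eqxx.
by have -> : last x (nseq k x) = x by [elim: k]; rewrite eqxx.
Qed.

Lemma divdiff_rec_rcons a b f x u y : x < y ->
  divdiff_rec a b f (size u).+1 (x :: rcons u y) =
  (divdiff_rec a b f (size u) (rcons u y) -
   divdiff_rec a b f (size u) (x :: u)) / (y - x).
Proof.
by move=> lt_xy /=; rewrite last_rcons lt_eqF // -cats1 take_size_cat.
Qed.

End divided_difference_recursion.

(** * Taylor polynomials and divisibility by powers of X - x *)

Section taylor_polynomials.
Context {R : realFieldType}.
Implicit Types (p : {poly R}) (x : R).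

Lemma derivn_XsubC_exp x i j :
  (('X - x%:P) ^+ j)^`(i).[x] = (i == j)%:R * j`!%:R.
Proof.
elim: i j => [|i IHi] [|j].
- by rewrite expr0 hornerC mul1r.
- by rewrite derivn0 horner_exp hornerXsubC subrr expr0n /= mul0r.
- by rewrite derivSn derivC linear0 horner0 mul0r.
rewrite derivSn deriv_exp derivB derivX derivC subr0 mul1r derivnMn hornerMn IHi.
by rewrite eqSS factS natrM -mulr_natr mulrA mulrAC -!mulrA.
Qed.

Lemma dvdp_derivn p x i j :
  ('X - x%:P) ^+ j %| p -> ('X - x%:P) ^+ (j - i) %| p^`(i).
Proof.
elim: i p j => [|i IHi] p [|j]; rewrite ?subn0 ?dvd1p // => dvd_p.
rewrite subSS derivSn; apply: IHi.
have [q ->] := dvdpP _ _ dvd_p.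
rewrite derivM deriv_exp derivB derivX derivC subr0 mul1r /=.
apply: dvdp_add; apply: dvdp_mull; first by rewrite exprSr dvdp_mulr.
by rewrite -mulr_natr dvdp_mulr.
Qed.

Lemma dvdp_root_derivn p x i j : (i < j)%N ->
  ('X - x%:P) ^+ j %| p -> p^`(i).[x] = 0.
Proof.
move=> lt_ij /(@dvdp_derivn _ _ i) dvd_p; apply/rootP; rewrite -dvdp_XsubCl.
by apply: dvdp_trans dvd_p; rewrite -(prednK (n := (j - i)%N)) ?subn_gt0 //
  exprS dvdp_mulr.
Qed.

(** Factors are peeled off one at a time: at the same point one power of X - x cancels, and at any
    other point coprimality removes X - x. *)
Lemma prod_XsubC_dvdp p (s : seq R) :
  (forall x, ('X - x%:P) ^+ count_mem x s %| p) ->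
  \prod_(x <- s) ('X - x%:P) %| p.
Proof.
elim: s p => [|x s IHs] p dvd_p; first by rewrite big_nil dvd1p.
have /dvdpP[q def_p] : 'X - x%:P %| p.
  by apply: dvdp_trans (dvd_p x); rewrite /= eqxx exprS dvdp_mulr.
rewrite big_cons mulrC def_p dvdp_mul2r ?polyXsubC_eq0 //; apply: IHs => y.
move: (dvd_p y); rewrite def_p /=; have [<-|neq_xy] := eqVneq x y.
  by rewrite add1n exprSr dvdp_mul2r ?polyXsubC_eq0.
by rewrite Gauss_dvdpl // coprimep_expl // coprimep_XsubC2 // subr_eq0.
Qed.

Definition taylor (d : nat -> R) k x : {poly R} :=
  \sum_(i < k) (d i / i`!%:R) *: ('X - x%:P) ^+ i.

Lemma size_taylor d k x : (size (taylor d k x) <= k)%N.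
Proof.
apply: (leq_trans (size_sum _ _ _)); apply/bigmax_leqP => i _.
by rewrite (leq_trans (size_scale_leq _ _)) // size_exp_XsubC.
Qed.

Lemma coef_taylor d k x : (taylor d k.+1 x)`_k = d k / k`!%:R.
Proof.
rewrite /taylor big_ord_recr /= coefD -/(taylor d k x) nth_default ?size_taylor //.
have /monicP := monic_exp k (monicXsubC x).
by rewrite add0r coefZ lead_coefE size_exp_XsubC => ->; rewrite mulr1.
Qed.

Lemma derivn_taylor d k x i : (i < k)%N -> (taylor d k x)^`(i).[x] = d i.
Proof.
move=> lt_ik; rewrite /taylor linear_sum horner_sum (bigD1 (Ordinal lt_ik)) //=.
rewrite big1 ?addr0 => [|j neq_ji]; rewrite linearZ hornerZ derivn_XsubC_exp.
  by rewrite eqxx mul1r divfK // pnatr_eq0 -lt0n fact_gt0.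
by rewrite -val_eqE eq_sym in neq_ji; rewrite (negPf neq_ji) mul0r mulr0.
Qed.

Lemma dvdp_taylor d k l x : (k <= l)%N ->
  ('X - x%:P) ^+ k %| taylor d k x - taylor d l x.
Proof.
move=> /subnKC <-; rewrite /taylor big_split_ord /= opprD addNKr dvdpNr.
apply: (big_ind (fun p => _ %| p)) => [|p q|i _]; [exact: dvdp0|exact: dvdp_add|].
by rewrite -mul_polyC dvdp_mull // dvdp_exp2l // leq_addr.
Qed.

End taylor_polynomials.

(** * Hermite interpolation *)

Section hermite_interpolation.
Context {R : realType} (a b : R) (f : R -> R) (n : nat).
Implicit Types (x : R) (s : seq R) (P : {poly R}).

(* [P] agrees with [f] at the points of [s], counted with multiplicity.  The
   choice of [n] is irrelevant as long as no multiplicity exceeds [n.+1]. *)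
Definition interpolates P s := forall x,
  ('X - x%:P) ^+ count_mem x s %| P - taylor (derive_onn a b ^~ f ^~ x) n.+1 x.

Lemma interpolates_taylor k x : (k <= n.+1)%N ->
  interpolates (taylor (derive_onn a b ^~ f ^~ x) k x) (nseq k x).
Proof.
move=> le_kn y; rewrite count_nseq /=.
by have [<-|] := eqVneq; rewrite ?mul1n ?dvdp_taylor // mul0n dvd1p.
Qed.

(** Turns divisibility back into equality of derivatives. The bound on [size s] keeps [i] at most
    [n], where the Taylor polynomial has the prescribed derivative. *)
Lemma interpolates_derivn P s x i : (size s <= n.+1)%N -> interpolates P s ->
  (i < count_mem x s)%N -> P^`(i).[x] = derive_onn a b i f x.
Proof.
move=> le_sn P_s lt_is; have le_in : (i < n.+1)%N.
  by rewrite (leq_trans lt_is) // (leq_trans (count_size _ _)).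
have := dvdp_root_derivn lt_is (P_s x).
by rewrite linearB hornerD hornerN derivn_taylor // => /subr0_eq.
Qed.

(* Neville's recursion *)
Lemma interpolates_rcons x u y P Q : x != y ->
  interpolates P (x :: u) -> interpolates Q (rcons u y) ->
  interpolates ((y - x)^-1 *: (('X - x%:P) * Q - ('X - y%:P) * P)) (x :: rcons u y).
Proof.
move=> neq_xy P_xu Q_uy z; set T := taylor _ _ _.
have yx_neq0 : y - x != 0 by rewrite subr_eq0 eq_sym.
(* Since (X - x) - (X - y) = y - x, subtracting [T] from the combination amounts to subtracting it
   from both [P] and [Q]. *)
rewrite (_ : _ - T = (y - x)^-1 *:
  (('X - x%:P) * (Q - T) - ('X - y%:P) * (P - T))); last first.
  rewrite -[T in LHS]scale1r -(mulVf yx_neq0) -scalerA -scalerBr.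
  by congr (_ *: _); rewrite -mul_polyC polyCB; ring.
rewrite dvdpZr ?invr_neq0 // dvdp_sub //.
- have := Q_uy z; rewrite -/T /= -cats1 !count_cat; have [<-|_] := eqVneq x z.
    by rewrite add1n exprS => dvdQ; rewrite dvdp_mul2l ?polyXsubC_eq0.
  by rewrite add0n => dvdQ; rewrite dvdp_mull.
- have := P_xu z; rewrite -/T /= -cats1 !count_cat /= addn0 [(y == z)]eq_sym.
  have [->|_] := eqVneq z y.
    by rewrite addnA addn1 exprS => dvdP; rewrite dvdp_mul2l ?polyXsubC_eq0.
  by rewrite addn0 => dvdP; rewrite dvdp_mull.
Qed.

(** Taylor polynomials serve for constant lists and Neville's recursion for the others; the
    coefficients of top index then obey the recursion of divided differences. *)
Lemma hermite_interpolation s : sorted <=%R s -> (0 < size s <= n.+1)%N ->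
  exists P, [/\ interpolates P s, (size P <= size s)%N &
    P`_(size s).-1 = divdiff_rec a b f (size s).-1 s].
Proof.
move=> s_sorted /andP[s_gt0]; move: s s_sorted s_gt0.
apply: sorted_ends_ind => [k x|x u y lt_xy IHxu IHuy];
  rewrite /= ?size_nseq ?size_rcons => le_n.
  exists (taylor (derive_onn a b ^~ f ^~ x) k.+1 x).
  by split; rewrite ?size_taylor ?coef_taylor ?divdiff_rec_nseq //;
    exact: (@interpolates_taylor k.+1).
have [P [P_xu sP P_lead]] := IHxu (ltnW le_n).
rewrite size_rcons in IHuy; have [Q [Q_uy sQ Q_lead]] := IHuy (ltnW le_n).
exists ((y - x)^-1 *: (('X - x%:P) * Q - ('X - y%:P) * P)); split.
- by apply: interpolates_rcons; rewrite ?lt_eqF.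
- rewrite (leq_trans (size_scale_leq _ _)) // (leq_trans (size_polyD _ _)) //.
  rewrite size_polyN geq_max; apply/andP; split;
    by rewrite (leq_trans (size_polyMleq _ _)) // size_XsubC.
(* Multiplication by X - z moves the top coefficient up by one index, unchanged. *)
have top z (T : {poly R}) : (size T <= (size u).+1)%N ->
    (('X - z%:P) * T)`_(size u).+1 = T`_(size u).
  move=> sT; rewrite mulrBl coefB coefXM coefCM [T`_(_.+1)]nth_default //.
  by rewrite mulr0 subr0.
by rewrite divdiff_rec_rcons // coefZ coefB !top // P_lead Q_lead mulrC.
Qed.

(** Both polynomials interpolate at [s], so their difference is a multiple of the node polynomial of
    [s]. Its degree leaves only a constant factor, read off at index [size s]. *)
Lemma interpolates_step c P Q s t : 
  interpolates P s -> interpolates Q t -> perm_eq t (c :: s) ->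
  (size P <= size s)%N -> (size Q <= size t)%N ->
  Q = P + Q`_(size s) *: \prod_(x <- s) ('X - x%:P).
Proof.
move=> P_s Q_t t_cs sP sQ; have s_t := perm_size t_cs.
have /dvdpP[r def_r] : \prod_(x <- s) ('X - x%:P) %| Q - P.
  apply: prod_XsubC_dvdp => x; set T := taylor (derive_onn a b ^~ f ^~ x) n.+1 x.
  rewrite -(subrK T Q) -addrA dvdp_add // ?(dvdp_trans _ (Q_t x)) //.
    by rewrite (permP t_cs) /= addnC exprD dvdp_mulr.
  by rewrite -dvdpNr opprB.
have size_prod : size (\prod_(x <- s) ('X - x%:P)) = (size s).+1.
  exact: size_prod_XsubC.
have r_const : r = (r`_0)%:P.
  apply: size1_polyC; have [->|r_neq0] := eqVneq r 0; first by rewrite size_poly0.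
  have : (size (Q - P)%R <= (size s).+1)%N.
    rewrite (leq_trans (size_polyD _ _)) // size_polyN geq_max.
    by rewrite (leqW sP) (leq_trans sQ) ?s_t.
  rewrite def_r size_Mmonic ?monic_prod_XsubC // size_prod /=.
  by rewrite addnS /= -[(size s).+1]add1n leq_add2r.
have {}def_r : Q = P + r`_0 *: \prod_(x <- s) ('X - x%:P).
  by rewrite -mul_polyC -r_const -def_r addrC subrK.
suff <- : r`_0 = Q`_(size s) by [].
rewrite def_r coefD coefZ (nth_default _ sP) add0r.
have /monicP := monic_prod_XsubC s predT id.
by rewrite lead_coefE size_prod => /= ->; rewrite mulr1.
Qed.

End hermite_interpolation.

(** * Rolle's theorem with multiplicities *)

Section rolle.
Context {R : realType} (a b : R).
Implicit Types (x y u v l : R) (F : R -> R) (G : nat -> R -> R) (s : seq R).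

Definition has_derive_on F x l :=
  diff_quotient F x y @[y --> within `[a, b] x^'] --> l.

Lemma has_derive_onB F1 F2 x l1 l2 :
  has_derive_on F1 x l1 -> has_derive_on F2 x l2 ->
  has_derive_on (F1 \- F2) x (l1 - l2).
Proof.
move=> d1 d2; rewrite /has_derive_on.
rewrite (_ : diff_quotient _ _ = diff_quotient F1 x \- diff_quotient F2 x).
  exact: cvgB.
by apply/funext => y; rewrite /diff_quotient /=; ring.
Qed.

(** Writing p - p(x) = q (X - x) turns the difference quotient into the continuous function q, and
    q(x) = p'(x). *)
Lemma has_derive_on_horner (p : {poly R}) x : has_derive_on (horner p) x p^`().[x].
Proof.
have /factor_theorem[q def_p] : root (p - p.[x]%:P) x.
  by rewrite /root hornerD hornerN hornerC subrr.
have p_E y : p.[y] = p.[x] + q.[y] * (y - x).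
  have := congr1 (horner^~ y) def_p; rewrite hornerD hornerN hornerC hornerM.
  by rewrite hornerXsubC => <-; rewrite addrC subrK.
have -> : p^`().[x] = q.[x].
  have := congr1 (fun r => r^`().[x]) def_p.
  rewrite derivB derivC subr0 derivM derivXsubC mulr1 hornerD hornerM.
  by rewrite hornerXsubC subrr mulr0 add0r.
move=> U /(@continuous_horner _ q x) qU.
have {}qU : nbhs x (fun y => U q.[y]) := qU.
suff : nbhs x (fun y => y != x -> y \in `[a, b] -> U (diff_quotient (horner p) x y)) by [].
move: qU; apply: filterS => y qyU neq_yx _.
by rewrite /diff_quotient p_E addrAC subrr add0r mulfK // subr_eq0.
Qed.

(** Near an interior point the restriction to [a, b] is void, and the shift y = h + x gives the
    usual quotient. *)
Lemma has_derive_on_is_derive F x l : x \in `]a, b[ ->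
  has_derive_on F x l -> is_derive x 1 F l.
Proof.
move=> x_ab dF; suff cvF : h^-1 *: ((F \o shift x) (h *: 1) - F x) @[h --> 0^'] --> l.
  by apply: DeriveDef; [apply/cvg_ex; exists l|apply: cvg_lim].
move=> U /dF /= qU; have nbhs_ab : nbhs x `[a, b]%classic.
  by apply: filterS (near_in_itvoo x_ab) => y /= /subset_itv_oo_cc.
have {qU} : nbhs x (fun y => y != x -> U (diff_quotient F x y)).
  near=> y => neq_yx; have : `[a, b]%classic y by near: y.
  by move: neq_yx; near: y.
have h_x : (h + x) @[h --> (0 : R)] --> x.
  by rewrite -[X in _ --> X]add0r; apply: cvgD; [exact: cvg_id|exact: cvg_cst].
move=> /h_x hU.
have {}hU : nbhs (0 : R)
  (fun h : R => h + x != x -> U (diff_quotient F x (h + x))) := hU.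
suff : nbhs (0 : R) (fun h : R =>
  h != 0 -> U (h^-1 *: ((F \o shift x) (h *: 1) - F x))) by [].
move: hU; apply: filterS => h /= hU neq_h0.
have := hU; rewrite -subr_eq0 addrK => /(_ neq_h0).
by rewrite /diff_quotient addrK mulrC /shift /= /GRing.scale /= mulr1.
Unshelve. all: by end_near.
Qed.

(** F(y) is F(x) plus the difference quotient times y - x; the quotient converges and y - x tends to
    0. *)
Lemma has_derive_on_continuous F dF :
  {in `[a, b], forall x, has_derive_on F x (dF x)} ->
  {within `[a, b], continuous F}.
Proof.
move=> F_derive; apply/subspace_continuousP => x x_ab U U_Fx.
have lim_F : F x + diff_quotient F x y * (y - x) @[y --> within `[a, b] x^'] --> F x.
  rewrite -[X in _ --> X]addr0 -[X in _ + X](mulr0 (dF x)) -[X in _ * X](subrr x).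
  apply: cvgD; first exact: cvg_cst.
  apply: cvgM; first exact: F_derive.
  apply: cvgB; last exact: cvg_cst.
  by apply: cvg_trans (cvg_within _) _; apply: cvg_within.
have Fq_U : nbhs x (fun y => y != x -> y \in `[a, b] ->
  U (F x + diff_quotient F x y * (y - x))) := lim_F _ U_Fx.
suff : nbhs x (fun y => y \in `[a, b] -> U (F y)) by [].
move: Fq_U; apply: filterS => y yU y_ab.
have [->|neq_yx] := eqVneq y x; first exact: nbhs_singleton.
by have := yU neq_yx y_ab; rewrite /diff_quotient divfK ?subr_eq0 // addrC subrK.
Qed.

Lemma rolle_on F dF u v :
  {in `[a, b], forall x, has_derive_on F x (dF x)} ->
  a <= u -> u < v -> v <= b -> F u = F v ->
  exists2 c, u < c < v & dF c = 0.
Proof.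
move=> F_derive le_au lt_uv le_vb F_uv.
have F_is_derive x : x \in `]u, v[ -> is_derive x 1 F (dF x).
  move=> /andP[/=]; rewrite !bnd_simp => lt_ux lt_xv.
  have x_ab : x \in `]a, b[.
    by rewrite in_itv /= (le_lt_trans le_au) // (lt_le_trans lt_xv).
  by apply/has_derive_on_is_derive/F_derive/subset_itv_oo_cc.
have [||c c_uv [_ dFc]] := @Rolle _ F u v lt_uv _ _ F_uv.
- by move=> x /F_is_derive [].
- apply: continuous_subspaceW (has_derive_on_continuous F_derive) => x /=.
  by rewrite !in_itv /= => /andP[? ?]; rewrite (le_trans le_au) // (le_trans _ le_vb).
exists c; first by rewrite in_itv in c_uv.
by case: (F_is_derive c c_uv) => _ <-.
Qed.

(* In passing from [x :: s] to [s'], repeated points lose one multiplicity and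
   each gap between distinct consecutive points contributes a new point. *)
Lemma rolle_seq F dF x s :
  {in `[a, b], forall x, has_derive_on F x (dF x)} ->
  path <=%R x s -> {subset x :: s <= `[a, b]} -> {in x :: s, forall y, F y = 0} ->
  exists s', [/\ path <=%R x s', size s' = size s, {subset s' <= `[a, b]} &
    forall y, (count_mem y s' <= (count_mem y (x :: s)).-1)%N \/
      [/\ y \notin x :: s, (count_mem y s' <= 1)%N & dF y = 0]].
Proof.
move=> F_derive; elim: s x => [|y s IHs] x.
  by move=> _ _ _; exists [::]; split=> // y; left.
move=> /= /andP[le_xy y_s] s_ab F0.
have [|||s' [y_s' size_s' s'_ab count_s']] := IHs y.
- by [].
- by move=> z z_s; apply: s_ab; rewrite inE z_s orbT.
- by move=> z z_s; apply: F0; rewrite inE z_s orbT.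
have x_ab : x \in `[a, b] by apply: s_ab; rewrite mem_head.
have y_ab : y \in `[a, b] by apply: s_ab; rewrite !inE eqxx orbT.
(* Equal neighbours contribute the point itself to the new list. *)
have [eq_xy|neq_xy] := eqVneq x y.
  rewrite -{}eq_xy in y_s y_s' count_s' *.
  exists (x :: s'); split; rewrite /= ?lexx ?size_s' //.
    by move=> z; rewrite inE => /predU1P[->//|/s'_ab].
  move=> z; have [|[z_s le1 dFz]] := count_s' z; rewrite /=.
    by case: (x == z); rewrite ?add1n ?add0n => le_c; left.
  right; move: z_s; rewrite !inE orbA orbb => z_xs; split => //.
  by move: z_xs; rewrite negb_or eq_sym => /andP[/negPf->].
have {neq_xy}lt_xy : x < y by rewrite lt_neqAle neq_xy.
have [||//|c /andP[lt_xc lt_cy] dFc] := rolle_on F_derive _ lt_xy.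
- by have := x_ab; rewrite in_itv => /andP[].
- by have := y_ab; rewrite in_itv => /andP[].
- by rewrite !F0 // !inE eqxx ?orbT.
(* All entries of [s] and [s'] are at least [y], so neither [c] nor [x] occurs among them. *)
have ge_y z r : path <=%R y r -> z \in r -> y <= z.
  by rewrite (path_sortedE le_trans) => /andP[/allP ge_yr _] /ge_yr.
have count_lt z r : path <=%R y r -> z < y -> count_mem z r = 0%N.
  move=> y_r lt_zy; apply/count_memPn/negP => /(ge_y _ _ y_r).
  by rewrite leNgt lt_zy.
exists (c :: s'); split; rewrite /= ?size_s' //.
- rewrite (ltW lt_xc) /=; case: (s') y_s' => //= d r /andP[le_yd ->].
  by rewrite (le_trans (ltW lt_cy)).
- move=> z; rewrite inE => /predU1P[->|/s'_ab //].
  move: x_ab y_ab; rewrite !in_itv /= => /andP[le_ax _] /andP[_ le_yb].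
  by rewrite (le_trans le_ax) ?(ltW lt_xc) // (le_trans (ltW lt_cy)).
move=> z; have [<-|neq_cz] := eqVneq c z.
  right; rewrite count_lt // addn0; split=> //.
  rewrite !inE !negb_or gt_eqF // lt_eqF //=; apply/negP => /(ge_y _ _ y_s).
  by rewrite leNgt lt_cy.
rewrite add0n; have [<-|neq_xz] := eqVneq x z; first by left; rewrite count_lt.
have [le_c|[z_s le1 dFz]] := count_s' z; [by left; rewrite add0n|right].
by split => //; rewrite inE negb_or eq_sym neq_xz.
Qed.

(** Each use of [rolle_seq] costs one zero, counted with multiplicity, so n + 1 zeros of [G 0] leave
    one for its n-th derivative [G n]. *)
Lemma rolle_iter n G s :
  (forall k, (k < n)%N -> {in `[a, b], forall x, has_derive_on (G k) x (G k.+1 x)}) ->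
  sorted <=%R s -> size s = n.+1 -> {subset s <= `[a, b]} ->
  (forall x i, (i < count_mem x s)%N -> G i x = 0) ->
  exists2 c, c \in `[a, b] & G n c = 0.
Proof.
elim: n G s => [|n IHn] G [|x s] // G_derive x_s [size_s] s_ab G0.
  by exists x; [apply: s_ab; rewrite mem_head|apply: G0; rewrite /= eqxx].
have [|s' [x_s' size_s' s'_ab count_s']] := rolle_seq (G_derive 0%N isT) x_s s_ab.
  by move=> y; rewrite -has_pred1 has_count => /G0.
apply: (IHn (fun k => G k.+1) s') => //.
- by move=> k lt_kn; apply: G_derive.
- exact: path_sorted x_s'.
- by rewrite size_s'.
(* An old point has lost one multiplicity, which matches the shift of [G]; a new point occurs only
   once, so [i] is 0. *)
move=> y i lt_i; have [le_c|[_ le1 dFy]] := count_s' y.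
  apply: G0; case: (count_mem y (x :: s)) le_c => [|c] /= le_c.
    by rewrite ltnNge (leq_trans le_c) in lt_i.
  by rewrite ltnS (leq_trans lt_i).
by move: (leq_trans lt_i le1); rewrite ltnS leqn0 => /eqP->.
Qed.

End rolle.

(** Lets Rolle's theorem run on a subinterval [u, v] while the derivatives remain those taken in
    [a, b]. *)
Lemma has_derive_onW (R : realType) (a b u v : R) F x l : a <= u -> v <= b ->
  has_derive_on a b F x l -> has_derive_on u v F x l.
Proof.
move=> le_au le_vb dF U /dF abU.
have {}abU : nbhs x (fun y => y != x -> y \in `[a, b] -> U (diff_quotient F x y)) := abU.
suff : nbhs x (fun y => y != x -> y \in `[u, v] -> U (diff_quotient F x y)) by [].
move: abU; apply: filterS => y yU neq_yx y_uv; apply: yU => //.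
by apply: subset_itvScc y_uv; rewrite bnd_simp.
Qed.

(** * Mean value theorem for divided differences *)

Section mean_value.
Context {R : realType} (a b : R) (f : R -> R) (n : nat).
Hypothesis f_Cn : Cn_on a b n f.

(** f minus its Hermite interpolant P has n + 1 zeros in [u, v], so its n-th derivative vanishes at
    some c there. The n-th derivative of P is the constant n! times its coefficient of index n, the
    divided difference. *)
Lemma divdiff_rec_mean_value u v s : a <= u -> v <= b ->
  sorted <=%R s -> size s = n.+1 -> {subset s <= `[u, v]} ->
  exists2 c, c \in `[u, v] & divdiff_rec a b f n s = derive_onn a b n f c / n`!%:R.
Proof.
move=> le_au le_vb s_sorted size_s s_uv.
have [|P [P_s size_P P_lead]] := @hermite_interpolation _ a b f n s s_sorted.
  by rewrite size_s /=.
pose G k := derive_onn a b k f \- horner P^`(k).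
have [||c c_uv] := @rolle_iter _ u v n G s _ s_sorted size_s s_uv.
- move=> k lt_kn x x_uv; apply: has_derive_onB; last first.
    by rewrite derivnS; exact: has_derive_on_horner.
  apply: (has_derive_onW le_au le_vb); apply: f_Cn.1 => //.
  by apply: subset_itvScc x_uv; rewrite bnd_simp.
- by move=> x i lt_i; rewrite /G /= (interpolates_derivn _ P_s lt_i) ?size_s ?subrr.
rewrite /G /= => /subr0_eq f_c; exists c => //; rewrite f_c.
have P_size1 : (size P^`(n) <= 1)%N.
  apply/leq_sizeP => j; rewrite coef_derivn => j_gt0.
  by rewrite nth_default ?mul0rn // (leq_trans size_P) // size_s -addn1 leq_add2l.
rewrite size_s /= in P_lead; rewrite (size1_polyC P_size1) hornerC coef_derivn addn0.
by rewrite -P_lead ffactnn -[_ *+ _]mulr_natr mulfK // pnatr_eq0 -lt0n fact_gt0.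
Qed.

(** The factor [e] carries the sign: 1 for convexity, -1 for concavity. *)
Lemma derive_onn_ge0 (e : R) : a < b ->
  (forall s, size s = n.+1 -> sorted <=%R s -> uniq s -> {subset s <= `[a, b]} ->
     0 <= e * divdiff_rec a b f n s) ->
  forall x, x \in `[a, b] -> 0 <= e * derive_onn a b n f x.
Proof.
move=> lt_ab dd_ge0 x x_ab; rewrite leNgt; apply/negP => fx_lt0.
have ef_x : e * derive_onn a b n f y @[y --> within `[a, b] (nbhs x)] -->
    e * derive_onn a b n f x.
  apply: cvgM; first exact: cvg_cst.
  by move: f_Cn.2 => /subspace_continuousP; apply.
have : nbhs x (fun y => y \in `[a, b] -> e * derive_onn a b n f y < 0).
  exact: (ef_x _ (lt_nbhsl fx_lt0)).
move=> /nbhs_ballP[r /= r_gt0 ball_lt0].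
have /andP[le_ax le_xb] : a <= x <= b by rewrite in_itv in x_ab.
(* The half radius puts [u, v] strictly inside the ball; max and min keep it in [a, b]. *)
pose u := Num.max a (x - r / 2); pose v := Num.min b (x + r / 2).
have le_au : a <= u by rewrite le_max lexx.
have le_vb : v <= b by rewrite ge_min lexx.
have lt_uv : u < v.
  by rewrite gt_max !lt_min; apply/andP; split; apply/andP; split; lra.
(* Dividing by n + 1 rather than n gives n + 1 distinct points of [u, v] even when n = 0. *)
pose s := mkseq (fun i => u + (v - u) * (i%:R / n.+1%:R)) n.+1.
have s_uv : {subset s <= `[u, v]}.
  move=> y /mapP[i]; rewrite mem_iota add0n => /andP[_ lt_in] ->.
  have : 0 <= (i%:R / n.+1%:R : R) <= 1.
    apply/andP; split; first by rewrite divr_ge0.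
    by rewrite ler_pdivrMr ?ltr0Sn // mul1r ler_nat ltnW.
  move: (_ / _) => w /andP[w_ge0 w_le1]; rewrite in_itv /=.
  by apply/andP; split; nra.
have : sorted <%R s.
  rewrite sorted_map; apply: sub_sorted (iota_ltn_sorted 0 n.+1) => i j /= lt_ij.
  by rewrite ltrD2l ltr_pM2l ?subr_gt0 // ltr_pM2r ?invr_gt0 ?ltr0Sn // ltr_nat.
rewrite lt_sorted_uniq_le => /andP[s_uniq s_sorted].
have uv_ab : {subset `[u, v] <= `[a, b]}.
  by apply: subset_itvScc; rewrite bnd_simp.
have [] := divdiff_rec_mean_value le_au le_vb s_sorted _ s_uv.
  by rewrite size_mkseq.
move=> c c_uv dd_c; have := dd_ge0 s; rewrite size_mkseq dd_c mulrA.
move=> /(_ erefl s_sorted s_uniq).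
rewrite pmulr_lge0 ?invr_gt0 ?ltr0n ?fact_gt0 // leNgt => /(_ _)/negP; apply.
  by move=> y /s_uv/uv_ab.
apply: ball_lt0; last exact: uv_ab.
move: c_uv; rewrite in_itv /= le_min ge_max /ball /= ltr_norml.
by move=> /andP[/andP[_ ?] /andP[_ ?]]; apply/andP; split; lra.
Qed.

End mean_value.

(** * Convexity and the sign of the n-th derivative *)

Section convexity.
Context {R : realType} (a b : R).
Implicit Types (f : R -> R) (n : nat) (s : seq R).

(* Repeated points are excluded because [derive_on] takes a junk value where
   [f] is not derivable. *)
Lemma divdiff_recN f s : sorted <=%R s -> (0 < size s)%N -> uniq s ->
  divdiff_rec a b (\- f) (size s).-1 s = - divdiff_rec a b f (size s).-1 s.
Proof.
move: s; apply: sorted_ends_ind => [[|k] x|x u y lt_xy IHxu IHuy].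
- by move=> _ /=; rewrite eqxx mulNr.
- by rewrite /= inE eqxx.
rewrite size_rcons in IHuy; rewrite /= size_rcons.
rewrite mem_rcons inE negb_or => /andP[/andP[_ x_u] uy_uniq].
rewrite !divdiff_rec_rcons // IHuy // IHxu /= ?x_u.
  by rewrite -mulNr opprD.
by move: uy_uniq; rewrite rcons_uniq => /andP[].
Qed.

Lemma n_convex_derive_ge0 n f : a < b -> Cn_on a b n f -> n_convex a b n f ->
  forall x, x \in `[a, b] -> 0 <= derive_onn a b n f x.
Proof.
move=> lt_ab f_Cn f_convex x x_ab; rewrite -[leRHS]mul1r.
apply: derive_onn_ge0 x_ab => // s size_s s_sorted s_uniq s_ab; rewrite mul1r.
have := f_convex s size_s s_uniq s_ab.
by rewrite /divdiff size_s sorted_sort //; exact: le_trans.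
Qed.

(** The minus sign moves out of the divided differences by [divdiff_recN], so differentiability of
    -f never comes up. *)
Lemma n_concave_derive_le0 n f : a < b -> Cn_on a b n f -> n_concave a b n f ->
  forall x, x \in `[a, b] -> derive_onn a b n f x <= 0.
Proof.
move=> lt_ab f_Cn f_concave x x_ab; rewrite -oppr_ge0 -mulN1r.
apply: derive_onn_ge0 x_ab => // s size_s s_sorted s_uniq s_ab; rewrite mulN1r.
have := f_concave s size_s s_uniq s_ab.
rewrite /divdiff sorted_sort ?divdiff_recN ?size_s //; exact: le_trans.
Qed.

End convexity.

(** * Newton's form and the remainder formula *)

Section newton.
Context {R : realType} (a b : R) (lt_ab : a < b) (f : R -> R) (n m : nat).
Hypothesis f_Cn : Cn_on a b n f.

(* Newton's form of the interpolant at [b], [m] times, and [a], [k] times. *)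
Definition newton k : {poly R} :=
  taylor (derive_onn a b ^~ f ^~ b) m b +
  \sum_(1 <= i < k.+1) divdiff a b f (nseq m b ++ nseq i a) *:
    (('X - b%:P) ^+ m * ('X - a%:P) ^+ i.-1).

Lemma sorted_nodes k t : t \in `[a, b] ->
  sorted <=%R (nseq k a ++ t :: nseq m b).
Proof.
rewrite in_itv /= => /andP[le_at le_tb].
have sorted_nseq i x : sorted <=%R (nseq i x).
  by case: i => // i /=; elim: i => //= i ->; rewrite lexx.
rewrite sorted_pairwise; last exact: le_trans.
rewrite pairwise_cat /= -!sorted_pairwise ?sorted_nseq; try exact: le_trans.
rewrite !andbT; apply/andP; split; last first.
  by apply/allP => x /nseqP[-> _].
apply/allrelP => x y /nseqP[-> _]; rewrite inE => /predU1P[->//|/nseqP[-> _]].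
exact: ltW.
Qed.

Lemma prod_nodes k :
  \prod_(x <- nseq k a ++ nseq m b) ('X - x%:P) =
  ('X - b%:P) ^+ m * ('X - a%:P) ^+ k.
Proof. by rewrite big_cat !big_nseq !iter_mulr_1 mulrC. Qed.

(** The nodes at b alone give the Taylor polynomial; each further node a adds one Newton term by
    [interpolates_step]. *)
Lemma newton_interpolates k : (0 < m)%N -> (k + m <= n.+1)%N ->
  interpolates a b f n (newton k) (nseq k a ++ nseq m b) /\
  (size (newton k) <= k + m)%N.
Proof.
move=> m_gt0; elim: k => [|k IHk] le_kn.
  rewrite /newton big_nil addr0 size_taylor; split=> //.
  exact: interpolates_taylor.
have [N_s size_N] := IHk (ltnW le_kn).
have size_s i : size (nseq i a ++ nseq m b) = (i + m)%N.
  by rewrite size_cat !size_nseq.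
have s_sorted : sorted <=%R (nseq k.+1 a ++ nseq m b).
  have b_ab : b \in `[a, b] by rewrite in_itv /= lexx ltW.
  (* Taking t = b lists b once too often; dropping that copy keeps the list sorted. *)
  apply: (subseq_sorted le_trans) (sorted_nodes k.+1 b_ab).
  by rewrite cat_subseq // subseq_cons.
have [|Q [Q_s size_Q Q_lead]] := @hermite_interpolation _ a b f n _ s_sorted.
  by rewrite size_s.
suff -> : newton k.+1 = Q by rewrite -(size_s k.+1).
rewrite (interpolates_step N_s Q_s (perm_refl _)) //; last by rewrite size_s.
rewrite [size (_ ++ _)]size_s.
rewrite /newton big_nat_recr //= addrA prod_nodes; congr (_ + _ *: _).
rewrite size_s in Q_lead; rewrite Q_lead /divdiff.
(* [divdiff] sorts its nodes, so listing b before a changes nothing. *)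
have perm_s : perm_eq (nseq m b ++ nseq k.+1 a) (nseq k.+1 a ++ nseq m b).
  exact/permPl/perm_catC.
rewrite (perm_size perm_s) size_s (elimT (perm_sort_leP _ _) perm_s).
by rewrite sorted_sort //; exact: le_trans.
Qed.

(** Let Q interpolate f at t as well. Then Q(t) = f(t), and Q exceeds Newton's polynomial by a
    divided difference, which is f^(n)(c) / n!, times the node polynomial. If t is a or b, only a
    multiplicity grows, so no case is special. *)
Lemma newton_remainder t : (0 < m <= n)%N -> t \in `[a, b] ->
  exists2 c, c \in `[a, b] & f t = (newton (n - m)).[t] +
    derive_onn a b n f c / n`!%:R * ((t - b) ^+ m * (t - a) ^+ (n - m)).
Proof.
move=> /andP[m_gt0 le_mn] t_ab.
have [|N_s size_N] := @newton_interpolates (n - m) m_gt0; first by rewrite subnK.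
set s := _ ++ _ in N_s; pose s1 := nseq (n - m) a ++ t :: nseq m b.
have size_s : size s = n by rewrite size_cat !size_nseq subnK.
have s1_s : perm_eq s1 (t :: s) by apply/permPl; exact: (perm_catCA _ [:: t]).
have size_s1 : size s1 = n.+1 by rewrite (perm_size s1_s) /= size_s.
have s1_sorted : sorted <=%R s1 by exact: sorted_nodes.
have [|Q [Q_s1 size_Q Q_lead]] := @hermite_interpolation _ a b f n s1 s1_sorted.
  by rewrite size_s1 /=.
have s1_ab : {subset s1 <= `[a, b]}.
  move=> x; rewrite mem_cat inE => /orP[/nseqP[-> _]|/predU1P[->//|/nseqP[-> _]]].
    by rewrite in_itv /= lexx ltW.
  by rewrite in_itv /= lexx ltW.
have [c c_ab dd_c] :=
  divdiff_rec_mean_value f_Cn (lexx a) (lexx b) s1_sorted size_s1 s1_ab.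
exists c => //; have <- : Q.[t] = f t.
  apply: (@interpolates_derivn _ a b f n Q s1 t 0%N) => //; first by rewrite size_s1.
  by rewrite -has_count has_pred1 mem_cat mem_head orbT.
rewrite (interpolates_step N_s Q_s1 s1_s) ?size_s ?subnK //;
  last by rewrite subnK in size_N.
rewrite prod_nodes hornerD hornerZ hornerM !horner_exp !hornerXsubC.
by rewrite size_s1 /= dd_c in Q_lead; rewrite Q_lead.
Qed.

End newton.

(** * Positive linear functionals *)

Section functional.
Context {R : realType} {E : Type} (L : {pred E -> R}).
Hypothesis L_vector_space : GRing.submod_closed L.
Context (A : (E -> R) -> R).
Hypothesis A_pos_lin : positive_linear_functional L A.

Lemma functional_sum (I : eqType) (r : seq I) (c : I -> R) (h : I -> E -> R) :
  {in r, forall i, h i \in L} ->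
  \sum_(i <- r) c i *: h i \in L /\
  A (\sum_(i <- r) c i *: h i) = \sum_(i <- r) c i * A (h i).
Proof.
have [L0 L_lin] := L_vector_space; have [A_add A_scale _] := A_pos_lin.
elim: r => [|i r IHr] h_L; rewrite ?(big_nil, big_cons).
  (* [A] vanishes at 0 by homogeneity, 0 being 0 times itself. *)
  by split=> //; rewrite -(scale0r (0 : E -> R)) A_scale // mul0r.
have [|r_L A_r] := IHr; first by move=> j j_r; rewrite h_L // inE j_r orbT.
have hi_L : h i \in L by rewrite h_L ?mem_head.
have ci_L : c i *: h i \in L by rewrite -[_ *: _]addr0 L_lin.
by split; [exact: L_lin|rewrite A_add // A_scale // A_r].
Qed.

Lemma functional_le h1 h2 : h1 \in L -> h2 \in L -> (forall t, h1 t <= h2 t) ->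
  A h1 <= A h2.
Proof.
have [_ L_lin] := L_vector_space; have [A_add A_scale A_pos] := A_pos_lin.
move=> h1_L h2_L le_h.
have sub_L : -1 *: h1 + h2 \in L by exact: L_lin.
have -> : h2 = h1 + (-1 *: h1 + h2) by rewrite scaleN1r addNKr.
by rewrite A_add // lerDl A_pos // => t; rewrite scaleN1r /= addrC subr_ge0.
Qed.

End functional.

Theorem theorem2p2 (R : realType) (E : Type) (E_nonempty : inhabited E)
  (L : {pred E -> R}) (L_vector_space : GRing.submod_closed L)
  (L_one : (cst 1 : E -> R) \in L)
  (A : (E -> R) -> R) (A_pos_lin : positive_linear_functional L A)
  (A_one : A (cst 1) = 1)
  (a b : R) (lt_ab : a < b)
  (n m : nat) (m_ge3 : (3 <= m)%N) (m_le : (m <= n.-1)%N)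
  (f : R -> R) (f_Cn : Cn_on a b n f)
  (g : E -> R) (g_in : g \in L) (g_range : forall t, g t \in `[a, b])
  (fg_in : f \o g \in L)
  (* the arguments of A in the conclusion belong to its domain *)
  (pow_in : forall k, (2 <= k <= m.-1)%N -> (g - cst b) ^+ k \in L)
  (prod_in : forall k, (1 <= k <= n - m)%N ->
     (g - cst b) ^+ m * (g - cst a) ^+ k.-1 \in L) :
  let dd := divdiff a b f in
  let rhs :=
    (b - A g) * (dd [:: a; b] - dd [:: b; b])
    + \sum_(2 <= k < m) derive_onn a b k f b / (k`!)%:R * A ((g - cst b) ^+ k)
    + \sum_(1 <= k < (n - m).+1)
        dd (nseq m b ++ nseq k a)
        * A ((g - cst b) ^+ m * (g - cst a) ^+ k.-1) in
  ((n_convex a b n f /\ odd m) \/ (n_concave a b n f /\ ~~ odd m) ->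
     LR f g a b A <= rhs) /\
  ((n_convex a b n f /\ ~~ odd m) \/ (n_concave a b n f /\ odd m) ->
     rhs <= LR f g a b A).
Proof.
move=> dd rhs; have [_ L_lin] := L_vector_space.
have [A_add A_scale _] := A_pos_lin.
have m_gt0 : (0 < m)%N by exact: leq_trans m_ge3.
have le_mn : (m <= n)%N := leq_trans m_le (leq_pred n).
pose Ng := horner (newton a b f m (n - m)) \o g.
have gb_E : g - cst b = (- b) *: cst 1 + g.
  apply/funext => t; change (g t - b = - b * 1 + g t); ring.
(* The powers 0 and 1 lie in [L] through the constant 1 and g; [pow_in] supplies the others. *)
have pow_L k : k \in index_iota 0 m -> (g - cst b) ^+ k \in L.
  rewrite mem_index_iota => /andP[_ lt_km].
  case: k lt_km => [_|[_|k lt_km]]; first by rewrite expr0.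
    by rewrite expr1 gb_E L_lin.
  by apply: pow_in; rewrite -(ltnS _ m.-1) prednK.
have prod_L k : k \in index_iota 1 (n - m).+1 ->
    (g - cst b) ^+ m * (g - cst a) ^+ k.-1 \in L.
  by rewrite mem_index_iota ltnS; exact: prod_in.
have [T_L A_T] := functional_sum L_vector_space A_pos_lin
  (fun k => derive_onn a b k f b / k`!%:R) pow_L.
have [D_L A_D] := functional_sum L_vector_space A_pos_lin
  (fun k => dd (nseq m b ++ nseq k a)) prod_L.
have Ng_E : Ng = \sum_(0 <= k < m) (derive_onn a b k f b / k`!%:R) *: (g - cst b) ^+ k
    + \sum_(1 <= k < (n - m).+1) dd (nseq m b ++ nseq k a) *:
        ((g - cst b) ^+ m * (g - cst a) ^+ k.-1).
  apply/funext => t; rewrite /Ng /newton /taylor /= hornerD !horner_sum big_mkord.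
  rewrite addrfctE !fct_sumE; congr (_ + _); apply: eq_bigr => k _.
    by rewrite hornerZ horner_exp hornerXsubC exprfctE.
  by rewrite hornerZ hornerM !horner_exp !hornerXsubC !exprfctE.
have Ng_L : Ng \in L by rewrite Ng_E -[X in X + _]scale1r L_lin.
(* The term with f[a, b] and the two endpoint terms of LR add up to f(b), the Taylor term of order
   0; the term with f[b, b] is the one of order 1. *)
have rhs_E : rhs - LR f g a b A = A Ng - A (f \o g).
  have dd_ab : dd [:: a; b] = (f b - f a) / (b - a).
    rewrite /dd /divdiff sorted_sort /=; last by rewrite ltW.
      by rewrite lt_eqF // !eqxx !divr1.
    exact: le_trans.
  have dd_bb : dd [:: b; b] = derive_onn a b 1 f b.
    rewrite /dd /divdiff sorted_sort /=; last by rewrite lexx.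
      by rewrite eqxx divr1.
    exact: le_trans.
  have A_gb : A (g - cst b) = A g - b.
    by rewrite gb_E A_add ?A_scale ?A_one ?mulr1 1?addrC //
      -[_ *: _]addr0 L_lin // L_vector_space.1.
  rewrite Ng_E A_add // A_T A_D big_ltn // big_ltn ?(ltnW m_ge3) //.
  rewrite expr0 expr1 A_gb A_one /rhs /LR dd_ab dd_bb.
  have ba_neq0 : b - a != 0 by rewrite subr_eq0 gt_eqF.
  rewrite fact0 (factS 0) fact0 muln1 /=.
  by field.
have fg_E t : exists2 c, c \in `[a, b] &
    (f \o g) t = Ng t + derive_onn a b n f c / n`!%:R *
      ((g t - b) ^+ m * (g t - a) ^+ (n - m)).
  by apply: newton_remainder; rewrite ?m_gt0.
have gb_le0 t : g t - b <= 0.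
  by have := g_range t; rewrite in_itv /= subr_le0 => /andP[].
have ga_ge0 t : 0 <= (g t - a) ^+ (n - m).
  by apply: exprn_ge0; have := g_range t; rewrite in_itv /= subr_ge0 => /andP[].
have convex_ge0 := n_convex_derive_ge0 lt_ab f_Cn.
have concave_le0 := n_concave_derive_le0 lt_ab f_Cn.
have n_fact_gt0 : 0 < (n`!%:R)^-1 :> R by rewrite invr_gt0 ltr0n fact_gt0.
have pow_odd t : odd m -> (g t - b) ^+ m <= 0 by move=> /exprn_odd_le0->.
have pow_even t : ~~ odd m -> 0 <= (g t - b) ^+ m by move=> /exprn_even_ge0->.
(* By monotonicity of [A] it suffices to compare f and the interpolant at each g(t), where the sign
   of the remainder is settled by that of f^(n)(c) and the parity of m. *)
split=> cvx_m.
  rewrite -subr_ge0 rhs_E subr_ge0.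
  apply: (functional_le L_vector_space A_pos_lin) => // t.
  have [c c_ab ->] := fg_E t; rewrite gerDl -mulrA.
  case: cvx_m => -[cvx m_parity].
    rewrite mulr_ge0_le0 ?convex_ge0 // pmulr_rle0 // mulr_le0_ge0 //; exact: pow_odd.
  rewrite mulr_le0_ge0 ?concave_le0 // pmulr_rge0 // mulr_ge0 //; exact: pow_even.
rewrite -subr_le0 rhs_E subr_le0.
apply: (functional_le L_vector_space A_pos_lin) => // t.
have [c c_ab ->] := fg_E t; rewrite lerDl -mulrA.
case: cvx_m => -[cvx m_parity].
  rewrite mulr_ge0 ?convex_ge0 // pmulr_rge0 // mulr_ge0 //; exact: pow_even.
rewrite mulr_le0 ?concave_le0 // pmulr_rle0 // mulr_le0_ge0 //; exact: pow_odd.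
Qed.
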